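(* For every univariate graph polynomial $P(G;X)$ there is a univariate graph polynomial $Q(G;X)$ which is prefactor equivalent to $P(G;X)$ and such that the roots of $Q(G;X)$ are dense in $\mathbb{C}$, i.e. the set $\{z\in\mathbb{C}: Q(G;z)=0\text{ for some graph }G\}$ is dense in $\mathbb{C}$.
   Context: Graphs are finite, simple and undirected. A graph parameter is a function on graphs invariant under isomorphism. A univariate graph polynomial is of the form $\sum_{i=0}^{s(G)}h_i(G)X^i$ with $s$ a graph parameter with values in $\mathbb{N}$ and the $h_i$ integer-valued graph parameters. Two graphs are similar if they have the same number of vertices, the same number of edges and the same number of connected components. A similarity function (in one indeterminate) assigns to each graph $G$ an analytic function $f(G;\cdot)$ on a nonempty open set $U_G\subseteq\mathbb{C}$, where both $U_G$ and $f(G;\cdot)$ depend only on the similarity class of $G$ (typical examples: polynomials, rational functions). $P$ is prefactor reducible to $Q$ if there are similarity functions $f,g$ with common domains $U_G$ such that $P(G;x)=f(G;x)\cdot Q(G;g(G;x))$ for all graphs $G$ and all $x\in U_G$. $P$ and $Q$ are prefactor equivalent if each is prefactor reducible to the other. *)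

(* Defs.v *)
From HB Require Import structures.
From mathcomp Require Import all_boot all_order all_algebra.
From mathcomp Require Import all_classical all_reals all_analysis.
From mathcomp Require Import complex.

Set Implicit Arguments.
Unset Strict Implicit.
Unset Printing Implicit Defensive.

Import Order.TTheory GRing.Theory Num.Theory.
Import numFieldNormedType.Exports.

Local Open Scope classical_set_scope.
Local Open Scope complex_scope.
Local Open Scope ring_scope.

(* The usual topology of the complex plane: MathComp-Analysis equips a
   numFieldType with the topology of its norm, but does not find the instance
   on the type [R[i]] itself. *)
HB.instance Definition _ (R : rcfType) := PseudoMetricNormedZmod.copy R[i] R[i]^o.

Record sgraph := SGraph {
  vertex :> finType;
  adj : rel vertex;
  adj_sym : symmetric adj;
  adj_irrefl : irreflexive adj
}.

Definition edges (G : sgraph) : {set {set G}} :=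
  [set e : {set G} | [exists x : G, exists y : G, adj x y && (e == [set x; y]%SET)]].

Definition isomorphic (G H : sgraph) : Prop :=
  exists f : G -> H, bijective f /\ forall x y : G, adj (f x) (f y) = adj x y.

Definition graph_parameter (T : Type) (h : sgraph -> T) : Prop :=
  forall G H : sgraph, isomorphic G H -> h G = h H.

Definition graph_polynomial (P : sgraph -> {poly int}) : Prop :=
  exists (s : sgraph -> nat) (h : nat -> sgraph -> int),
    [/\ graph_parameter s,
        forall i : nat, graph_parameter (h i) &
        forall G : sgraph, P G = \sum_(0 <= i < (s G).+1) h i G *: 'X^i].

Definition similar_graphs (G H : sgraph) : Prop :=
  [/\ #|G| = #|H|,
      #|edges G| = #|edges H| &
      n_comp (@adj G) predT = n_comp (@adj H) predT].

Section Prefactor.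
Variable R : realType.

Definition ceval (p : {poly int}) (x : R[i]) : R[i] := (map_poly intr p).[x].

Definition analytic_at (f : R[i] -> R[i]) (z : R[i]) : Prop :=
  exists a : nat -> R[i],
    \forall w \near z, series (fun k => a k * (w - z) ^+ k) @ \oo --> f w.

(* The partial function [f G] with domain [U G] is represented by a total
   function whose values outside [U G] are irrelevant. *)
Definition similarity_function (U : sgraph -> set R[i])
    (f : sgraph -> R[i] -> R[i]) : Prop :=
  [/\ forall G, open (U G) /\ U G !=set0,
      forall G z, U G z -> analytic_at (f G) z,
      forall G H, similar_graphs G H -> U G = U H &
      forall G H, similar_graphs G H -> forall z, U G z -> f G z = f H z].

Definition prefactor_reducible (P Q : sgraph -> {poly int}) : Prop :=
  exists (U : sgraph -> set R[i]) (f g : sgraph -> R[i] -> R[i]),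
    [/\ similarity_function U f,
        similarity_function U g &
        forall G x, U G x -> ceval (P G) x = f G x * ceval (Q G) (g G x)].

Definition prefactor_equivalent (P Q : sgraph -> {poly int}) : Prop :=
  prefactor_reducible P Q /\ prefactor_reducible Q P.

Definition graph_roots (Q : sgraph -> {poly int}) : set R[i] :=
  [set z | exists G : sgraph, ceval (Q G) z = 0].

End Prefactor.

Arguments prefactor_reducible R P Q : clear implicits.
Arguments prefactor_equivalent R P Q : clear implicits.
Arguments graph_roots R Q _ : clear implicits.

(* Main.v *)
Require Import Defs.
From mathcomp Require Import all_boot all_order all_algebra.
From mathcomp Require Import all_classical all_reals all_analysis.
From mathcomp Require Import complex.
From mathcomp Require Import ring lra zify.

(* Take [Q G = F_n * P G] with [n = #|G|], where [F_n] runs through all the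
   quadratics [(a X - p)^2 + (2 q + 1)^2] with integers [a > 0], [p], [q].  Their
   roots [(p +/- i (2 q + 1)) / a] are already dense.  The factor depends only on
   the number of vertices, and [1 / F_n] is analytic off the two roots: they are
   distinct because [2 q + 1 != 0], so partial fractions reduce it to geometric
   series. *)

Set Implicit Arguments.
Unset Strict Implicit.
Unset Printing Implicit Defensive.

Import Order.TTheory GRing.Theory Num.Theory.
Import numFieldNormedType.Exports.

Local Open Scope classical_set_scope.
Local Open Scope complex_scope.
Local Open Scope ring_scope.

Lemma poly_graph_polynomial (P : sgraph -> {poly int}) :
  graph_parameter P -> graph_polynomial P.
Proof.
move=> hP; exists (fun G : sgraph => size (P G)), (fun i G => (P G)`_i).
split=> [G H /hP -> //|i G H /hP -> //|G].
(* With [size (P G)] as upper index, the sum has one term more than [P G] has coefficients; that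
   last term is zero. *)
rewrite big_mkord -[LHS](coefK (P G)) poly_def big_ord_recr /=.
by rewrite [(P G)`_(size _)]nth_default// scale0r addr0.
Qed.

Lemma graph_polynomial_parameter (P : sgraph -> {poly int}) :
  graph_polynomial P -> graph_parameter P.
Proof.
move=> [s [h [hs hh defP]]] G H GH; rewrite !defP (hs _ _ GH).
by apply: eq_bigr => i _; rewrite (hh i _ _ GH).
Qed.

Lemma card_isomorphic : graph_parameter (fun G : sgraph => #|G|).
Proof. by move=> G H [f [/bij_eq_card ? _]]. Qed.

Definition edgeless (n : nat) : sgraph :=
  @SGraph 'I_n (fun _ _ => false) (fun _ _ => erefl) (fun _ => erefl).

Section Analytic.
Variable R : realType.
Implicit Types (z w c t : R[i]) (p : {poly R[i]}).

Lemma cvg_expr_complex t : `|t| < 1 -> t ^+ n @[n --> \oo] --> 0.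
Proof.
rewrite normc_def => tlt1; move: (tlt1); rewrite ltcR => {}tlt1.
(* A positive [e] in [R[i]] has zero imaginary part, so what remains is convergence of the real
   geometric sequence of the modulus of [t]. *)
apply/cvgr0Pnorm_lt => e; rewrite ltcE /= => /andP[/eqP e0 egt0].
have nt : `|Num.sqrt (complex.Re t ^+ 2 + complex.Im t ^+ 2)| < 1.
  by rewrite ger0_norm ?sqrtr_ge0.
near=> n; rewrite normrX normc_def -rmorphXn ltcE /= e0 eqxx /=.
rewrite -[ltLHS]ger0_norm ?exprn_ge0 ?sqrtr_ge0//.
by near: n; have /cvgr0Pnorm_lt := cvg_expr nt; apply.
Unshelve. all: by end_near. Qed.

(** The Taylor coefficients at [z] are the coefficients of [p] composed with ['X + z%:P], and the
    partial sums are eventually constant. *)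
Lemma analytic_at_horner p z : analytic_at (fun w => p.[w]) z.
Proof.
exists (fun k => (p \Po ('X + z%:P))`_k); near=> w.
apply: cvg_near_cst; near=> n.
have -> : p.[w] = (p \Po ('X + z%:P)).[w - z].
  by rewrite horner_comp hornerD hornerX hornerC subrK.
rewrite (@horner_coef_wide _ n); last by near: n; exact: nbhs_infty_ge.
by rewrite /series /= big_mkord.
Unshelve. all: by end_near. Qed.

(** For [t = (w - z) / (c - z)] the value is [(c - z)^-1 * (1 - t)^-1], a geometric series that
    converges when [w] is closer to [z] than [c] is. *)
Lemma analytic_at_sub_inv c z : z != c -> analytic_at (fun w => (c - w)^-1) z.
Proof.
move=> zc; have cz0 : c - z != 0 by rewrite subr_eq0 eq_sym.
exists (fun k => (c - z) ^- k.+1); near=> w.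
have wz : `|(w - z) / (c - z)| < 1.
  rewrite normrM normfV ltr_pdivrMr ?normr_gt0// mul1r distrC.
  by near: w; apply: nbhsx_ballx; rewrite normr_gt0.
set t := (w - z) / (c - z) in wz *.
have t1 : t != 1 by apply: contraTneq wz => ->; rewrite normr1 ltxx.
have wE : c - w = (c - z) * (1 - t) by rewrite /t; field.
have -> : series (fun k => (c - z) ^- k.+1 * (w - z) ^+ k)
    = fun n => (c - w)^-1 * (1 - t ^+ n).
  apply/funext => n; rewrite /series /= big_mkord.
  have u1 : 1 - t != 0 by rewrite subr_eq0 eq_sym.
  apply: (mulfI (mulf_neq0 cz0 u1)); rewrite -wE mulVKf ?wE ?mulf_neq0//.
  have -> : 1 - t ^+ n = (1 - t) * \sum_(i < n) t ^+ i.
    by rewrite -opprB subrX1 -mulNr opprB.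
  rewrite [(c - z) * _]mulrC -mulrA; congr (_ * _); rewrite mulr_sumr.
  apply: eq_bigr => i _.
  rewrite mulrA exprS invfM mulrA mulfV// mul1r /t exprMn exprVn mulrC//.
rewrite -[X in _ --> X]mulr1 -{2}[1]subr0.
by apply: cvgMl_tmp; apply: cvgB; [exact: cvg_cst|exact: cvg_expr_complex].
Unshelve. all: by end_near. Qed.

(** This is the shape of the partial fractions used below, so that no product of power series has to
    be formed. *)
Lemma analytic_at_scaleB c (f g : R[i] -> R[i]) z :
  analytic_at f z -> analytic_at g z ->
  analytic_at (fun w => c * (f w - g w)) z.
Proof.
move=> [a fa] [b gb]; exists (fun k => c * (a k - b k)).
apply: filterS2 fa gb => w cf cg.
have -> : series (fun k => c * (a k - b k) * (w - z) ^+ k) =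
    fun n => c * (series (fun k => a k * (w - z) ^+ k) n
                - series (fun k => b k * (w - z) ^+ k) n).
  apply/funext => n; rewrite /series /= -sumrB mulr_sumr.
  by apply: eq_bigr => i _; rewrite -mulrA mulrBl.
exact: cvgMl_tmp (cvgB cf cg).
Qed.

End Analytic.

Section GaussianRationals.
Variable R : realType.
Implicit Types (a p b : int) (x y z : R[i]).

Definition gaussian_rational a p b : R[i] := (p%:~R + 'i%C * b%:~R) / a%:~R.

Definition gaussian_quadratic a p b : {poly int} :=
  (a *: 'X - p%:P) ^+ 2 + (b ^+ 2)%:P.

Lemma ceval_gaussian_quadratic a p b x : a != 0 ->
  ceval (gaussian_quadratic a p b) x =
    a%:~R ^+ 2 * ((gaussian_rational a p b - x)
                 * (gaussian_rational a p (- b) - x)).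
Proof.
move=> a0; have a0' : a%:~R != 0 :> R[i] by rewrite intr_eq0.
rewrite /ceval /gaussian_quadratic rmorphD rmorphXn rmorphB /= linearZ /=.
rewrite map_polyX !map_polyC /= !hornerE /gaussian_rational rmorphXn rmorphN /=.
have := sqr_i R; set i := 'i%C => i2.
(* Once the sum of squares is written as a difference of squares, the factorization is an identity
   in an indeterminate [i], which [field] can check. *)
transitivity ((a%:~R * x - p%:~R) ^+ 2 - i ^+ 2 * b%:~R ^+ 2).
  by rewrite i2 mulN1r opprK.
by field.
Qed.

Lemma imaginary_neq0 : 'i%C != 0 :> R[i].
Proof. by rewrite -sqrf_eq0 sqr_i oppr_eq0 oner_eq0. Qed.

Lemma gaussian_rational_neq a p b b' : a != 0 -> b != b' ->
  gaussian_rational a p b != gaussian_rational a p b'.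
Proof.
move=> a0 bb'; have a0' : a%:~R != 0 :> R[i] by rewrite intr_eq0.
apply: contraNneq bb' => /(divIf a0') /addrI /(mulfI imaginary_neq0) /intr_inj.
by move->.
Qed.

(** For fixed [a] these points form a grid with spacing [1 / a.+1] horizontally and [2 / a.+1]
    vertically, which becomes arbitrarily fine as [a] grows. *)
Lemma gaussian_rational_approx z (e : R[i]) : 0 < e ->
  exists (a : nat) (p q : int),
    `|z - gaussian_rational a.+1 p (2 * q + 1)| < e.
Proof.
rewrite ltcE /= => /andP[/eqP e0 egt0].
(* The constant 2 is a crude bound for the modulus of the error scaled by [a.+1], whose real and
   imaginary parts [A] and [B] are at most 1 in absolute value. *)
have [a ae] : exists a : nat, 2 / complex.Re e < a.+1%:R.
  by exists (Num.truncn (2 / complex.Re e)); exact: truncnS_gt.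
have a0 : 0 < a.+1%:R :> R by [].
(* Halving before taking the floor makes [2 * q + 1] an odd integer at distance at most 1 from the
   scaled imaginary part. *)
exists a, (Num.floor (a.+1%:R * complex.Re z)),
  (Num.floor (a.+1%:R * complex.Im z / 2)).
set p := Num.floor _; set q := Num.floor _.
pose A := a.+1%:R * complex.Re z - p%:~R : R.
pose B := a.+1%:R * complex.Im z - (2 * q + 1)%:~R : R.
have -> : z - gaussian_rational a.+1 p (2 * q + 1) =
    (a.+1%:R)%:C^-1 * (A%:C + 'i%C * B%:C).
  rewrite /A /B /gaussian_rational !rmorphB !rmorphM /= !rmorph_int.
  rewrite [z in LHS]complexE.
  have : a.+1%:R != 0 :> R[i] by rewrite pnatr_eq0.
  by rewrite -pmulrn !rmorph_nat; move: (a.+1%:R : R[i]) => k k0; field.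
have A1 : `|A| <= 1.
  rewrite /A ler_norml; move: (floor_itv (a.+1%:R * complex.Re z)).
  rewrite -/p intrD; lra.
have B1 : `|B| <= 1.
  rewrite /B ler_norml; move: (floor_itv (a.+1%:R * complex.Im z / 2)).
  rewrite -/q !intrD intrM; lra.
have AB : Num.sqrt (A ^+ 2 + B ^+ 2) <= 2.
  rewrite -[leRHS]ger0_norm// -sqrtr_sqr ler_sqrt ?sqr_ge0//.
  have : A ^+ 2 <= 1 by rewrite -real_normK ?num_real// exprn_ile1.
  have : B ^+ 2 <= 1 by rewrite -real_normK ?num_real// exprn_ile1.
  lra.
rewrite rmorph_nat normrM normfV normr_nat mulrC ltr_pdivrMr ?ltr0n//.
rewrite [e]complexE e0 mulr0 addr0 -(rmorph_nat (real_complex R)) -rmorphM.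
rewrite normc_def /= ltcR !mul0r !mul1r subr0 !addr0 !add0r.
by apply: le_lt_trans AB _; rewrite mulrC -ltr_pdivrMr//.
Qed.

Lemma analytic_at_inv_gaussian_quadratic a p b : a != 0 -> b != 0 ->
  exists f : R[i] -> R[i], forall z,
    z != gaussian_rational a p b -> z != gaussian_rational a p (- b) ->
    analytic_at f z /\ f z * ceval (gaussian_quadratic a p b) z = 1.
Proof.
move=> a0 b0; have uv : gaussian_rational a p b != gaussian_rational a p (- b).
  by rewrite gaussian_rational_neq// -addr_eq0 -mulr2n mulrn_eq0.
have a0' : a%:~R != 0 :> R[i] by rewrite intr_eq0.
set u := gaussian_rational a p b in uv *.
set v := gaussian_rational a p (- b) in uv *.
(* Partial fractions: [(u - z)^-1 - (v - z)^-1] equals [(v - u) / ((u - z) * (v - z))]. *)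
exists (fun z => (a%:~R ^+ 2 * (v - u))^-1 * ((u - z)^-1 - (v - z)^-1)).
move=> z zu zv.
split; first by apply: analytic_at_scaleB; exact: analytic_at_sub_inv.
rewrite ceval_gaussian_quadratic// -/u -/v; field.
by rewrite a0' !subr_eq0 ![_ == z]eq_sym zu zv eq_sym uv.
Qed.

End GaussianRationals.

(** The number [n] is decoded into a triple by countability. A number that codes no triple gets the
    harmless factor ['X^2 + 1]. The shapes [a.+1] and [2 * q + 1] keep both parameters nonzero. *)
Definition card_factor (n : nat) : {poly int} :=
  let: (a, p, q) := odflt (0%N, 0, 0) (unpickle n : option (nat * int * int)) in
  gaussian_quadratic a.+1 p (2 * q + 1).

Lemma analytic_at_ceval (R : realType) (F : {poly int}) (z : R[i]) :
  analytic_at (ceval F) z.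
Proof. exact: analytic_at_horner. Qed.

Lemma analytic_at_id (R : realType) (z : R[i]) : analytic_at (fun w => w) z.
Proof.
have -> : (fun w : R[i] => w) = horner 'X.
  by apply/funext => w; rewrite hornerX.
exact: analytic_at_horner.
Qed.

Lemma card_factor_inv (R : realType) (n : nat) :
  exists (U : set R[i]) (f : R[i] -> R[i]),
    [/\ open U, U !=set0, forall z, U z -> analytic_at f z &
        forall z, U z -> f z * ceval (card_factor n) z = 1].
Proof.
rewrite /card_factor; case: (odflt _ _) => [[a p] q].
have b0 : 2 * q + 1 != 0 by lia.
have a0 : a.+1%:Z != 0 by [].
have [f fE] := analytic_at_inv_gaussian_quadratic R p a0 b0.
set u := gaussian_rational R a.+1 p (2 * q + 1) in fE.
set v := gaussian_rational R a.+1 p (- (2 * q + 1)) in fE.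
have closed1 (x : R[i]) : open (~` [set x]).
  apply: closed_openC; apply: accessible_closed_set1.
  apply: hausdorff_accessible; exact: norm_hausdorff.
exists (~` [set u] `&` ~` [set v]), f; split.
- exact: openI.
(* The midpoint of the two roots is neither of them. *)
- exists (gaussian_rational R a.+1 p 0); split; apply/eqP.
    by rewrite gaussian_rational_neq// eq_sym.
  by rewrite gaussian_rational_neq// eq_sym oppr_eq0.
- by move=> z [/eqP zu /eqP zv]; have [] := fE z zu zv.
- by move=> z [/eqP zu /eqP zv]; have [] := fE z zu zv.
Qed.

Lemma card_factor_roots_dense (R : realType) (z e : R[i]) : 0 < e ->
  exists n (w : R[i]), `|z - w| < e /\ ceval (card_factor n) w = 0.
Proof.
move=> /(gaussian_rational_approx z)[a [p [q zw]]].
exists (pickle (a, p, q)), (gaussian_rational R a.+1 p (2 * q + 1)); split=> //.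
by rewrite /card_factor pickleK ceval_gaussian_quadratic// subrr mul0r mulr0.
Qed.

Lemma cevalM (R : realType) (F G : {poly int}) (x : R[i]) :
  ceval (F * G) x = ceval F x * ceval G x.
Proof. by rewrite /ceval rmorphM hornerM. Qed.

Theorem theorem4p21 (R : realType) (P : sgraph -> {poly int})
    (hP : graph_polynomial P) :
  exists Q : sgraph -> {poly int},
    [/\ graph_polynomial Q,
        prefactor_equivalent R P Q &
        dense (graph_roots R Q)].
Proof.
exists (fun G : sgraph => card_factor #|G| * P G); split.
- apply: poly_graph_polynomial => G H GH.
  by rewrite (card_isomorphic GH) (graph_polynomial_parameter hP GH).
(* Choosing domain and inverse for each number [n], rather than for each graph, makes them agree on
   similar graphs. *)
- have [U /choice[f Uf]] := choice (card_factor_inv R).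
  split.
  + exists (fun G : sgraph => U #|G|), (fun G : sgraph => f #|G|),
      (fun _ z => z); split.
    * split=> [G|G z|G H [-> _ _]//|G H [-> _ _]//].
        by have [] := Uf #|G|.
      by have [_ _ + _] := Uf #|G|; apply.
    * split=> [G|G z _|G H [-> _ _]//|G H [-> _ _]//].
        by have [] := Uf #|G|.
      exact: analytic_at_id.
    * move=> G x Ux; rewrite cevalM mulrA.
      by have [_ _ _ ->] := Uf #|G|; rewrite ?mul1r.
  (* In this direction the prefactor is the polynomial factor itself, analytic on the whole
     plane. *)
  + exists (fun=> setT), (fun G : sgraph => ceval (card_factor #|G|)),
      (fun _ z => z); split.
    * split=> [G|G z _|//|G H [-> _ _]//].
        by split; [exact: openT|exists 0].
      exact: analytic_at_ceval.
    * split=> [G|G z _|//|//].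
        by split; [exact: openT|exists 0].
      exact: analytic_at_id.
    * by move=> G x _; rewrite cevalM.
- move=> O [z Oz] oO.
  have /nbhs_ballP[e /= e0 eO] := open_nbhs_nbhs (conj oO Oz).
  have [n [w [zw w0]]] := card_factor_roots_dense z e0.
  exists w; split; first exact: eO.
  (* Any graph on [n] vertices would do: a root of the factor is a root of the product, whatever [P]
     is. *)
  by exists (edgeless n); rewrite /= cevalM card_ord w0 mul0r.
Qed.
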